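(* Let $S=\{i_1,i_2,\dots,i_k\}\subset\{2,3,\dots,n\}$ and let $R=\{n-i_1+1,\,n-i_2+1,\dots,n-i_k+1\}\subset[n-1]$. Then there is a bijection between $\mathcal{C}_n$ and $\mathcal{B}_n$ that maps $\hat{P}_C(S;n)$ to $\hat{P}_B(R;n)$.
   Context: Notation: $[n]=\{1,\dots,n\}$; $\mathfrak{S}_{N}$ is the symmetric group on $[N]$, with permutations in one-line notation. $\mathcal{C}_n\subset\mathfrak{S}_{2n}$ (mirrored permutations of type $C_n$) is the subgroup of all $\pi_1\cdots\pi_n|\pi_{n+1}\cdots\pi_{2n}\in\mathfrak{S}_{2n}$ (the bar is only a visual separator) such that $\pi_{2n-i+1}=2n-\pi_i+1$ for all $i$. $\mathcal{B}_n$ is the group of signed permutations: sequences $\beta_1\beta_2\cdots\beta_n$ with $\beta_i\in\{-n,\dots,-1,1,\dots,n\}$ and $\{|\beta_1|,\dots,|\beta_n|\}=[n]$. For a sequence of distinct integers, a peak is an index $i$, neither the first nor the last index of the sequence, whose entry is larger than both neighboring entries; $P(\cdot)$ denotes the set of peaks. Define $\hat{P}_C(S;n)=\{\pi\in\mathcal{C}_n\mid P(\pi_1\pi_2\cdots\pi_n\pi_{n+1})=S\}$ (a peak at $n$ is allowed), and $\hat{P}_B(R;n)=\{\beta\in\mathcal{B}_n\mid P(\beta_0\beta_1\cdots\beta_n)=R\}$, where $\beta_0=0$ and indices start at $0$ (so a peak at $1$ is allowed). *)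

(* Defs.v *)
From mathcomp Require Export all_boot all_order all_fingroup all_algebra.
From mathcomp Require Export finmap.
From mathcomp Require Export boolp classical_sets functions.

Set Implicit Arguments.
Unset Strict Implicit.
Unset Printing Implicit Defensive.

Import GRing.Theory Num.Theory.

Local Open Scope fset_scope.
Local Open Scope classical_set_scope.
Local Open Scope ring_scope.

(* {m, m + 1, ..., n} *)
Definition irange (m n : nat) : {fset nat} := [fset i in index_iota m n.+1].

(* One-line notation of s on [N] = {1, ..., N}; the elements of 'I_N are
   counted from 0, hence the successor on the values. *)
Definition one_line (N : nat) (s : 'S_N) : seq int :=
  [seq (s i).+1%:Z | i <- enum 'I_N].

(* The peaks of s, where the entries of s are indexed by a, a + 1, ...; the
   position j below counts from 0 and skips the first and the last entry. *)
Definition peaks (a : nat) (s : seq int) : {fset nat} :=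
  [fset (a + j)%N | j in index_iota 1 (size s).-1
                  & (s`_j.-1 < s`_j) && (s`_j.+1 < s`_j)].

(* rev_ord is i |-> 2n - i + 1 when 'I_(2 * n) is identified with [2n]. *)
Definition mirrored_perms (n : nat) : set 'S_(2 * n) :=
  [set p : 'S_(2 * n) | forall i, p (rev_ord i) = rev_ord (p i)].

Definition signed_perms (n : nat) : set (n.-tuple int) :=
  [set b : n.-tuple int |
    (forall x, x \in b -> (x != 0) /\ (- n%:Z <= x <= n%:Z)) /\
    [fset `|x|%N | x in tval b] = irange 1 n].

Definition PhatC (S : {fset nat}) (n : nat) : set 'S_(2 * n) :=
  [set p : 'S_(2 * n) | mirrored_perms p /\
                        peaks 1 (take n.+1 (one_line p)) = S].

Definition PhatB (R : {fset nat}) (n : nat) : set (n.-tuple int) :=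
  [set b : n.-tuple int | signed_perms b /\ peaks 0 (0 :: tval b) = R].

Arguments mirrored_perms n : clear implicits.
Arguments signed_perms n : clear implicits.
Arguments PhatC S n : clear implicits.
Arguments PhatB R n : clear implicits.

(* Main.v *)
Require Import Defs.
From mathcomp Require Import zify.

Set Implicit Arguments.
Unset Strict Implicit.
Unset Printing Implicit Defensive.

Import GRing.Theory.

Local Open Scope fset_scope.
Local Open Scope classical_set_scope.
Local Open Scope ring_scope.

(** The increasing relabelling of [{1, ..., 2n}] by [{-n, ..., -1, 1, ..., n}]
    turns the mirror symmetry into [x |-> - x], so a mirrored permutation is
    determined by the relabelled first half [g_1 ... g_n], which is signed, and
    is followed by [g_(n+1) = - g_n].  Read this half backwards: the comparison
    of [g_n] with [- g_n] is the comparison of [g_n] with [0]. *)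

Lemma in_peaks a (s : seq int) j :
  ((a + j)%N \in peaks a s) =
  [&& (0 < j)%N, (j.+1 < size s)%N, s`_j.-1 < s`_j & s`_j.+1 < s`_j].
Proof.
apply/imfsetP/idP => [[k /= ]|/and4P[j0 js lt1 lt2]].
  rewrite !inE mem_index_iota => /andP[/andP[k0 ks] /andP[lt1 lt2]] /addnI ->.
  by rewrite k0 lt1 lt2 !andbT /=; lia.
exists j => //=; rewrite !inE mem_index_iota j0 lt1 lt2 !andbT /=; lia.
Qed.

(** Brings an arbitrary peak to the form [a + j] to which [in_peaks] applies. *)
Lemma peaksE a (s : seq int) i :
  i \in peaks a s -> exists2 j, i = (a + j)%N & (a + j)%N \in peaks a s.
Proof. by move=> si; case/imfsetP: (si) => j _ ij; exists j; rewrite -?ij. Qed.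

Lemma nth_one_line N (p : 'S_N) (i : 'I_N) : (one_line p)`_i = (p i).+1%:Z.
Proof. by rewrite (nth_map i) ?size_enum_ord // nth_ord_enum. Qed.

Lemma size_one_line N (p : 'S_N) : size (one_line p) = N.
Proof. by rewrite size_map size_enum_ord. Qed.

(* Ordinals count values from 0, so [v] stands for the entry [v + 1]. *)
Definition centered (n v : nat) : int :=
  if (v < n)%N then v%:Z - n%:Z else v%:Z - n%:Z + 1.

(** Inverse of [centered n] on the nonzero integers of $[-n, n]$; there both arguments of the
    absolute value are nonnegative, so it only casts to [nat]. *)
Definition uncentered (n : nat) (x : int) : nat :=
  if x < 0 then `|(x + n%:Z)%R|%N else `|(x + n%:Z - 1)%R|%N.

Lemma ltr_centered n v w : (centered n v < centered n w) = (v < w)%N.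
Proof. by rewrite /centered; do 2 case: ltnP => ?; lia. Qed.

Lemma centered_inj n : injective (centered n).
Proof. by move=> v w; rewrite /centered; do 2 case: ltnP => ?; lia. Qed.

Lemma centered_rev n (v : 'I_(2 * n)) :
  centered n (rev_ord v) = - centered n v.
Proof. by case: v => v /= hv; rewrite /centered; do 2 case: ltnP => ?; lia. Qed.

Lemma centered_neq0 n v : centered n v != 0.
Proof. by rewrite /centered; case: ltnP => ?; lia. Qed.

Lemma centered_bound n v :
  (v < 2 * n)%N -> - n%:Z <= centered n v <= n%:Z.
Proof. by move=> v2n; rewrite /centered; case: ltnP => ?; lia. Qed.

Lemma uncentered_lt n x :
  x != 0 -> - n%:Z <= x <= n%:Z -> (uncentered n x < 2 * n)%N.
Proof. by move=> x0 xn; rewrite /uncentered; case: ifP => ?; lia. Qed.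

Lemma uncenteredK n x :
  x != 0 -> - n%:Z <= x <= n%:Z -> centered n (uncentered n x) = x.
Proof.
by move=> x0 xn; rewrite /uncentered; case: ifP => ?; rewrite /centered; case: ltnP => ?; lia.
Qed.

(** Pigeonhole: [n] absolute values lying in $[n]$ exhaust it exactly when they are distinct.
    Distinctness is the easier form to check and to use. *)
Lemma signed_permsP n (b : n.-tuple int) :
  signed_perms n b <->
  (forall x, x \in b -> x != 0 /\ - n%:Z <= x <= n%:Z) /\
  uniq [seq `|x|%N | x <- b].
Proof.
have irangeE i : (i \in irange 1 n) = (i \in iota 1 n).
  by rewrite !inE /= /index_iota subn1.
have absE i : (i \in [fset `|x|%N | x in tval b]) = (i \in map absz b).
  apply/imfsetP/mapP => [[x]|[x]] xb ->; by exists x.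
split=> -[hb hu]; split=> //.
  have eqi : iota 1 n =i map absz b by move=> i; rewrite -irangeE -hu absE.
  by rewrite -(eq_uniq _ eqi) ?iota_uniq // size_iota size_map size_tuple.
apply/fsetP => i; rewrite irangeE absE.
have sub : {subset map absz b <= iota 1 n}.
  by move=> _ /mapP[x /hb[x0 xn] ->]; rewrite mem_iota; lia.
have [|_ -> //] := uniq_min_size hu sub.
by rewrite size_iota size_map size_tuple.
Qed.

Lemma leq_double_ord n : (n <= 2 * n)%N. Proof. by lia. Qed.

(** Sends [j] to [n - j.+1]: the backward reading is built into the embedding of positions. *)
Definition half_ord n (j : 'I_n) : 'I_(2 * n) :=
  widen_ord (leq_double_ord n) (rev_ord j).

Lemma half_ord_inj n : injective (@half_ord n).
Proof.
move=> i j /(congr1 val) /= eq_ij; apply: val_inj => /=.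
by have := ltn_ord i; have := ltn_ord j; lia.
Qed.

(** Combined with the mirror symmetry, this reduces equality of mirrored permutations to equality at
    the positions [half_ord j]. *)
Lemma half_ordP n (i : 'I_(2 * n)) :
  (exists j : 'I_n, i = half_ord j) \/ (exists j : 'I_n, i = rev_ord (half_ord j)).
Proof.
have [lt_in|le_ni] := ltnP i n.
  by left; exists (rev_ord (Ordinal lt_in)); apply: val_inj => /=; lia.
have lt_jn : (i - n < n)%N by have := ltn_ord i; lia.
by right; exists (Ordinal lt_jn); apply: val_inj => /=; have := ltn_ord i; lia.
Qed.

Lemma half_ord_neq_rev n (i j : 'I_n) : half_ord i <> rev_ord (half_ord j).
Proof. by move=> /(congr1 val) /=; have := ltn_ord i; have := ltn_ord j; lia. Qed.

Definition signed_of_mirrored n (p : 'S_(2 * n)) : n.-tuple int :=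
  [tuple centered n (p (half_ord j)) | j < n].

Lemma nth_signed_of_mirrored n (p : 'S_(2 * n)) (j : 'I_n) :
  (signed_of_mirrored p)`_j = centered n (p (half_ord j)).
Proof. by rewrite -tnth_nth tnth_mktuple. Qed.

Lemma signed_of_mirrored_signed n (p : 'S_(2 * n)) :
  mirrored_perms n p -> signed_perms n (signed_of_mirrored p).
Proof.
move=> hp; apply/signed_permsP; split=> [x /mapP[j _ ->]|].
  by rewrite centered_neq0 centered_bound.
rewrite map_inj_in_uniq.
  rewrite map_inj_uniq ?enum_uniq // => i j.
  by move=> /centered_inj /val_inj /perm_inj /half_ord_inj.
move=> _ _ /mapP[i _ ->] /mapP[j _ ->] eq_abs.
have [//|eq_opp] : centered n (p (half_ord i)) = centered n (p (half_ord j)) \/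
    centered n (p (half_ord i)) = - centered n (p (half_ord j)) by lia.
(* Opposite entries would be equal values of [p] at positions in opposite halves. *)
move: eq_opp; rewrite -centered_rev -hp => /centered_inj /val_inj /perm_inj.
by move=> /half_ord_neq_rev.
Qed.

Lemma signed_of_mirrored_inj n :
  {in mirrored_perms n &, injective (@signed_of_mirrored n)}.
Proof.
move=> p q /set_mem hp /set_mem hq eq_pq.
have eq_half j : p (half_ord j) = q (half_ord j).
  apply/val_inj/(@centered_inj n).
  by rewrite -!nth_signed_of_mirrored eq_pq.
apply/permP => i; have [[j ->]|[j ->]] := half_ordP i; first exact: eq_half.
by rewrite hp hq eq_half.
Qed.

Lemma signed_of_mirrored_surj n (b : n.-tuple int) : signed_perms n b ->
  exists2 p, mirrored_perms n p & signed_of_mirrored p = b.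
Proof.
move=> /signed_permsP[hb hu].
(* The whole relabelled word: [b] backwards, then the negatives of [b] in order. *)
pose x (i : 'I_(2 * n)) := if (i < n)%N then b`_(n - i.+1) else - b`_(i - n).
have hx i : x i != 0 /\ - n%:Z <= x i <= n%:Z.
  have ib k : (k < n)%N -> b`_k != 0 /\ - n%:Z <= b`_k <= n%:Z.
    by move=> kn; apply/hb/mem_nth; rewrite size_tuple.
  have i2n := ltn_ord i; rewrite /x; case: ltnP => ?.
    by apply: ib; lia.
  have [|] := ib (i - n)%N; lia.
have x_rev i : x (rev_ord i) = - x i.
  have i2n := ltn_ord i; rewrite /x /=; case: ltnP => ?; case: ltnP => ?; try lia.
    by rewrite opprK; congr (b`__); lia.
  by congr (- b`__); lia.
have x_inj : injective x.
  have b_inj k l : (k < n)%N -> (l < n)%N -> `|(b`_k)%R|%N = `|(b`_l)%R|%N -> k = l.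
    move=> kn ln; rewrite -!(nth_map 0 0%N absz) ?size_tuple // => /eqP.
    by rewrite nth_uniq ?size_map ?size_tuple // => /eqP.
  move=> i j eq_x; apply: val_inj => /=.
  have i2n := ltn_ord i; have j2n := ltn_ord j; have [xi0 _] := hx i.
  move: eq_x xi0; rewrite /x; case: ltnP => iP; case: ltnP => jP eq_x xi0.
  - have := b_inj (n - i.+1)%N (n - j.+1)%N; rewrite eq_x; lia.
  (* In this case and the next, [i] and [j] lie in different halves: an entry of [b] would equal its
     own negative, against [xi0]. *)
  - have := b_inj (n - i.+1)%N (j - n)%N ltac:(lia) ltac:(lia) ltac:(lia).
    by move=> eq_k; rewrite eq_k in eq_x xi0; lia.
  - have := b_inj (i - n)%N (n - j.+1)%N ltac:(lia) ltac:(lia) ltac:(lia).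
    by move=> eq_k; rewrite eq_k in eq_x xi0; lia.
  - have := b_inj (i - n)%N (j - n)%N ltac:(lia) ltac:(lia) ltac:(lia); lia.
pose q i : 'I_(2 * n) := Ordinal (uncentered_lt (hx i).1 (hx i).2).
have qK i : centered n (q i) = x i by apply: uncenteredK; case: (hx i).
have q_inj : injective q.
  by move=> i j eq_q; apply: x_inj; rewrite -!qK eq_q.
exists (perm q_inj).
  move=> i; rewrite !permE; apply/val_inj/(@centered_inj n).
  by rewrite centered_rev !qK x_rev.
apply: eq_from_tnth => j; rewrite tnth_mktuple permE qK (tnth_nth 0) /x /=.
by case: ltnP => ?; [congr (b`__)|]; have := ltn_ord j; lia.
Qed.

(** [centered] preserves order and the reversal swaps the two neighbours, so the comparisons match
    one by one; only a peak at $n$ involves the second half of [p]. *)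
Lemma peak_signed_of_mirrored n (p : 'S_(2 * n)) j :
  mirrored_perms n p -> (0 < j < n)%N ->
  ((1 + j)%N \in peaks 1 (take n.+1 (one_line p))) =
  ((0 + (n - j))%N \in peaks 0 (0 :: tval (signed_of_mirrored p))).
Proof.
move=> hp /andP[j0 jn]; rewrite !in_peaks size_take size_one_line.
have nth_s k (k2n : (k < 2 * n)%N) : (k < n.+1)%N ->
    (take n.+1 (one_line p))`_k = (p (Ordinal k2n)).+1%:Z.
  by move=> kn; rewrite nth_take // (nth_one_line p (Ordinal k2n)).
have nth_b k (k2n : (k < 2 * n)%N) : (k < n)%N ->
    (signed_of_mirrored p)`_(n - k.+1) = centered n (p (Ordinal k2n)).
  move=> kn; have h : (n - k.+1 < n)%N by lia.
  rewrite (nth_signed_of_mirrored p (Ordinal h)); congr (centered n (p _)).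
  by apply: val_inj => /=; lia.
move: (size_tuple (signed_of_mirrored p)) nth_b.
move: (tval (signed_of_mirrored p)) => b size_b nth_b; rewrite /= size_b.
have h0 : (j.-1 < 2 * n)%N by lia.
have h1 : (j < 2 * n)%N by lia.
have h2 : (j.+1 < 2 * n)%N by lia.
rewrite (nth_s _ h0) ?(nth_s _ h1) ?(nth_s _ h2); try lia.
have -> : (n - j = (n - j.+1).+1)%N by lia.
rewrite /= (nth_b _ h1) //.
have -> : ((n - j.+1).+1 = n - j.-1.+1)%N by lia.
rewrite (nth_b _ h0); last lia.
rewrite !ltz_nat !ltnS ltr_centered j0 /=.
have -> : (j.+1 < (if n.+1 < 2 * n then n.+1 else 2 * n))%N by case: ifP; lia.
have -> : (n - j.-1.+1 < n)%N by lia.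
rewrite /= andbC; congr andb.
have [j1n|nj1] := ltnP j.+1 n.
  have -> : (n - j.+1 = (n - j.+2).+1)%N by lia.
  by rewrite /= (nth_b _ h2) // ltr_centered.
(* Here [j.+1 = n]: the next entry of [p] is the mirror image of the current one, while the
   neighbour in the signed word is the prepended 0. With [x] the relabelled entry, [- x < x] if and
   only if [0 < x]. *)
have -> : (n - j.+1 = 0)%N by lia.
rewrite /= (_ : Ordinal h2 = rev_ord (Ordinal h1)); last first.
  by apply: val_inj => /=; lia.
rewrite hp -(ltr_centered n) centered_rev; lia.
Qed.

(** The end positions 1 and $n+1$ cannot be peaks. The upper bound keeps the truncated subtraction
    in [n - i + 1] exact. *)
Lemma peaks_mirrored_sub n (p : 'S_(2 * n)) :
  (peaks 1 (take n.+1 (one_line p)) `<=` irange 2 n)%fset.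
Proof.
apply/fsubsetP => i /peaksE[j ->]; rewrite in_peaks size_take size_one_line.
move=> /and4P[j0 jn _ _]; rewrite !inE /= mem_index_iota.
by move: jn; case: ifP; lia.
Qed.

Lemma peaks_signed_of_mirrored n (p : 'S_(2 * n)) : mirrored_perms n p ->
  peaks 0 (0 :: tval (signed_of_mirrored p)) =
  [fset (n - i + 1)%N | i in peaks 1 (take n.+1 (one_line p))].
Proof.
move=> hp; apply/fsetP => k; apply/idP/imfsetP => [hk|[i /= hi ->]].
  have kn : (0 < k < n)%N.
    move: hk; rewrite -[k]add0n in_peaks => /and4P[-> + _ _].
    by rewrite (size_tuple [tuple of 0 :: signed_of_mirrored p]) ltnS.
  (* The reflection [i |-> n - i + 1] is its own inverse on this range. *)
  exists (1 + (n - k))%N => /=; last lia.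
  rewrite peak_signed_of_mirrored //; last lia.
  by rewrite add0n subKn //; lia.
have iP : (1 < i < n.+1)%N.
  by move: (fsubsetP (peaks_mirrored_sub p) i hi); rewrite !inE mem_index_iota.
have [j ij] : exists j, i = (1 + j)%N by exists i.-1; lia.
move: hi; rewrite ij peak_signed_of_mirrored //; last lia.
by rewrite add0n (_ : (n - (1 + j) + 1 = n - j)%N) //; lia.
Qed.

(** Truncated subtraction sends every [i >= n] to 1, so injectivity of the reflection needs the
    bound by [n]. *)
Lemma rev_irange_inj n (S T : {fset nat}) :
  (S `<=` irange 2 n)%fset -> (T `<=` irange 2 n)%fset ->
  [fset (n - i + 1)%N | i in S] = [fset (n - i + 1)%N | i in T] -> S = T.
Proof.
move=> hS hT eqST.
have half A B : (A `<=` irange 2 n)%fset -> (B `<=` irange 2 n)%fset ->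
    [fset (n - i + 1)%N | i in A] = [fset (n - i + 1)%N | i in B] ->
    (A `<=` B)%fset.
  move=> /fsubsetP hA /fsubsetP hB eqAB; apply/fsubsetP => i iA.
  have : (n - i + 1)%N \in [fset (n - i + 1)%N | i in A] by apply/imfsetP; exists i.
  rewrite eqAB => /imfsetP[j /= jB]; move: (hA i iA) (hB j jB).
  rewrite !inE /= !mem_index_iota => iP jP eq_ij.
  by rewrite (_ : i = j) //; lia.
by apply/eqP; rewrite eqEfsubset; apply/andP; split; apply: half.
Qed.

Theorem proposition22 (n : nat) (S R : {fset nat})
    (hS : (S `<=` irange 2 n)%fset)
    (hR : R = [fset (n - i + 1)%N | i in S]%fset) :
  exists f : 'S_(2 * n) -> n.-tuple int,
    set_bij (mirrored_perms n) (signed_perms n) f /\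
    f @` PhatC S n = PhatB R n.
Proof.
exists (@signed_of_mirrored n); split.
  split; first exact: signed_of_mirrored_signed.
    exact: signed_of_mirrored_inj.
  by move=> b /signed_of_mirrored_surj[p hp <-]; exists p.
apply/seteqP; split=> [_ [p [hp pS] <-]|b [hb bR]].
  split; first exact: signed_of_mirrored_signed.
  by rewrite peaks_signed_of_mirrored // pS hR.
have [p hp pb] := signed_of_mirrored_surj hb; exists p => //; split=> //.
(* The peak set of the preimage [p] and [S] both reflect to [R], hence they coincide. *)
apply: (rev_irange_inj (peaks_mirrored_sub p) hS).
by rewrite -peaks_signed_of_mirrored // pb bR hR.
Qed.
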